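(* Let $c\ge1$ and let $G,H\in\mathcal{P}_c^*$ where $H$ is para-$G$ via $\phi$, and suppose that one of the following holds: (i) $G/G''$ and $H/H''$ are residually nilpotent; (ii) $|Z_{c-1}(G'):G''|<\infty$ and $|Z_{c-1}(H'):H''|<\infty$. Then $h(H)=h(G)$.
   Context: $\mathcal{P}_c^*$ is the class of polycyclic groups $G$ which are residually nilpotent ($\bigcap_i\gamma_i(G)=1$) and nilpotent of class $c$ by abelian, meaning that the derived subgroup $G'$ is nilpotent of class $c$. Here $\gamma_1(G)=G$, $\gamma_{i+1}(G)=[\gamma_i(G),G]$ is the lower central series, $G'=\gamma_2(G)$, $G''=(G')'$, and $Z_0(K)=1\le Z_1(K)=Z(K)\le\cdots$ is the upper central series of a group $K$. $h(G)$ is the Hirsch length of the polycyclic group $G$. $H$ is para-$G$ via $\phi$ if $\phi:G\to H$ is a monomorphism such that the induced map $G/\gamma_i(G)\to H/\gamma_i(H)$ is an isomorphism for every $i$. *)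

(* Defs.v *)
From HB Require Import structures.
From mathcomp Require Import all_boot all_classical.

Set Implicit Arguments.
Unset Strict Implicit.
Unset Printing Implicit Defensive.

Local Open Scope classical_set_scope.
Local Open Scope group_scope.
Local Open Scope quotient_scope.

(* Subgroups of a (possibly infinite) group are classical sets, so that all  *)
(* the notions below are relative to an ambient groupType.  Commutators are  *)
(* those of MathComp: [~ x, y] = x^-1 * y^-1 * x * y.                        *)

Definition is_subgroup (G : groupType) (A : set G) : Prop :=
  A 1 /\ forall x y, A x -> A y -> A (x / y).

Definition is_normal_in (G : groupType) (B A : set G) : Prop :=
  B `<=` A /\ forall x y, B x -> A y -> B (x ^ y).

Definition commutator (G : groupType) (A B : set G) : set G :=
  smallest (@is_subgroup G) [set z | exists x y, [/\ A x, B y & z = [~ x, y]]].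

Definition derived (G : groupType) (A : set G) : set G := commutator A A.

(* Indexed as in the literature: the first term is K (and so is the 0th).    *)
Definition lower_central (G : groupType) (K : set G) (i : nat) : set G :=
  iter i.-1 (fun A => commutator A K) K.

(* Z_{i+1}(K) / Z_i(K) is the centre of K / Z_i(K).                          *)
Fixpoint upper_central (G : groupType) (K : set G) (i : nat) : set G :=
  if i is j.+1 then
    [set x | K x /\ forall y, K y -> upper_central K j [~ x, y]]
  else [set 1].

Definition residually_nilpotent (G : groupType) : Prop :=
  \bigcap_(i >= 1) lower_central [set: G] i = [set 1].

(* The class is exact: c is the least number with this property.             *)
Definition nilpotent_of_class (G : groupType) (K : set G) (c : nat) : Prop :=
  lower_central K c.+1 = [set 1] /\
  forall d, (d < c)%N -> lower_central K d.+1 <> [set 1].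

Definition left_coset (G : groupType) (x : G) (B : set G) : set G :=
  [set x * y | y in B].

(* |A : B| < oo                                                              *)
Definition finite_index (G : groupType) (A B : set G) : Prop :=
  finite_set [set left_coset x B | x in A].

(* A / B is cyclic                                                           *)
Definition cyclic_factor (G : groupType) (A B : set G) : Prop :=
  exists2 a, A a & forall x, A x -> exists n : nat,
    left_coset x B = left_coset (a ^+ n) B \/
    left_coset x B = left_coset (a ^- n) B.

Definition polycyclic_series (G : groupType) (n : nat) (s : nat -> set G) :
    Prop :=
  [/\ s 0%N = [set: G], s n = [set 1],
      forall i, (i <= n)%N -> is_subgroup (s i) &
      forall i, (i < n)%N ->
        is_normal_in (s i.+1) (s i) /\ cyclic_factor (s i) (s i.+1)].

Definition polycyclic (G : groupType) : Prop :=
  exists n s, @polycyclic_series G n s.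

Definition infinite_factors (G : groupType) (n : nat) (s : nat -> set G) : nat :=
  \sum_(i < n) `[< ~ finite_index (s i) (s i.+1) >].

(* The number of infinite factors is the same for all polycyclic series of G *)
(* (Schreier), so which series is picked is irrelevant.  The value is 0 if G *)
(* is not polycyclic.                                                        *)
Definition hirsch_length (G : groupType) : nat :=
  xget 0%N [set h | exists n s,
                      @polycyclic_series G n s /\ h = infinite_factors n s].

Record polycyclic_res_nilpotent_by_abelian (c : nat) (G : groupType) : Prop := {
  prna_polycyclic : polycyclic G;
  prna_residual : residually_nilpotent G;
  prna_class : nilpotent_of_class (derived [set: G]) c
}.

Record normal_subgroup (G : groupType) := NormalSubgroup {
  nset :> set G;
  nset_subgroup : is_subgroup nset;
  nset_normal : is_normal_in nset [set: G]
}.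

Section Quotient.
Variables (G : groupType) (N : normal_subgroup G).

Lemma normal1 : nset N 1. Proof. by case: (nset_subgroup N). Qed.

Lemma normalF x y : nset N x -> nset N y -> nset N (x / y).
Proof. by case: (nset_subgroup N) => _; apply. Qed.

Lemma normalV x : nset N x -> nset N x^-1.
Proof. by move=> Nx; rewrite -div1g; exact/normalF/Nx/normal1. Qed.

Lemma normalM x y : nset N x -> nset N y -> nset N (x * y).
Proof. by move=> Nx Ny; rewrite -(invgK y); exact/normalF/normalV. Qed.

Lemma normalJ x y : nset N x -> nset N (x ^ y).
Proof. by case: (nset_normal N) => _ h Nx; exact: h. Qed.

Definition quotient_rel : rel G := fun x y => `[< nset N (x^-1 * y) >].

Lemma quotient_rel_refl : reflexive quotient_rel.
Proof. by move=> x; apply/asboolP; rewrite mulVg; exact: normal1. Qed.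

Lemma quotient_rel_sym : symmetric quotient_rel.
Proof.
by move=> x y; apply: asbool_equiv_eq; split=> /normalV; rewrite invgM invgK.
Qed.

Lemma quotient_rel_trans : transitive quotient_rel.
Proof.
move=> y x z /asboolP xy /asboolP yz; apply/asboolP.
by rewrite -(mulVKg y z) mulgA; exact: normalM.
Qed.

Canonical quotient_equiv :=
  EquivRel quotient_rel quotient_rel_refl quotient_rel_sym quotient_rel_trans.

Definition quotient := {eq_quot quotient_equiv}.

HB.instance Definition _ := Choice.on quotient.
HB.instance Definition _ := EqQuotient.on quotient.

Lemma quotientP x y :
  reflect (nset N (x^-1 * y)) (\pi_quotient x == \pi_quotient y).
Proof.
apply: (iffP idP); first by move/eqP/eqmodP/asboolP.
by move=> Nxy; apply/eqP/eqmodP/asboolP.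
Qed.

Definition quotient_one : quotient := \pi_quotient 1.

Definition quotient_inv (u : quotient) : quotient := \pi_quotient (repr u)^-1.

Definition quotient_mul (u v : quotient) : quotient :=
  \pi_quotient (repr u * repr v).

Lemma quotient_repr x : nset N (x^-1 * repr (\pi_quotient x)).
Proof. by apply/quotientP; rewrite reprK. Qed.

Lemma quotient_invE x : quotient_inv (\pi_quotient x) = \pi_quotient x^-1.
Proof.
apply/eqP; rewrite eq_sym; apply/quotientP; rewrite invgK.
set y := repr _; have := normalV (quotient_repr x); rewrite -/y invgM invgK.
by move/(@normalJ _ x^-1); rewrite /conjg invgK -!mulgA mulgV mulg1.
Qed.

Lemma quotient_mulE x y :
  quotient_mul (\pi_quotient x) (\pi_quotient y) = \pi_quotient (x * y).
Proof.
apply/eqP; rewrite eq_sym; apply/quotientP.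
set x' := repr _; set y' := repr _.
have -> : (x * y)^-1 * (x' * y') = (x^-1 * x') ^ y * (y^-1 * y').
  by rewrite /conjg invgM !mulgA mulgK.
apply: normalM; first by apply: normalJ; exact: quotient_repr.
exact: quotient_repr.
Qed.

Lemma quotient_mulA : associative quotient_mul.
Proof.
elim/(@quotW _ quotient) => x; elim/(@quotW _ quotient) => y; elim/(@quotW _ quotient) => z.
by rewrite !quotient_mulE mulgA.
Qed.

Lemma quotient_mul1 : left_id quotient_one quotient_mul.
Proof. by elim/(@quotW _ quotient) => x; rewrite quotient_mulE mul1g. Qed.

Lemma quotient_1mul : right_id quotient_one quotient_mul.
Proof. by elim/(@quotW _ quotient) => x; rewrite quotient_mulE mulg1. Qed.

Lemma quotient_mulV : left_inverse quotient_one quotient_inv quotient_mul.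
Proof. by elim/(@quotW _ quotient) => x; rewrite quotient_invE quotient_mulE mulVg. Qed.

Lemma quotient_Vmul : right_inverse quotient_one quotient_inv quotient_mul.
Proof. by elim/(@quotW _ quotient) => x; rewrite quotient_invE quotient_mulE mulgV. Qed.

HB.instance Definition _ := isGroup.Build quotient
  quotient_mulA quotient_mul1 quotient_1mul quotient_mulV quotient_Vmul.

End Quotient.

Section Commutators.
Variable G : groupType.
Implicit Types A B : set G.

Lemma commutator_subgroup A B : is_subgroup (commutator A B).
Proof.
split=> [C [[C1 _] _] //|x y Ax Ay C CP].
by case: (CP) => -[_ CF] _; apply: CF; [exact: Ax|exact: Ay].
Qed.

Lemma commutator_normal A B :
  is_normal_in A [set: G] -> is_normal_in B [set: G] ->
  is_normal_in (commutator A B) [set: G].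
Proof.
move=> [_ nA] [_ nB]; split=> // x y + _; rewrite /commutator /smallest.
move=> ABx C [[C1 CF] CAB]; apply: (ABx [set z | C (z ^ y)]); split.
  split=> [|u v /= Cu Cv]; first by rewrite /= conj1g.
  by rewrite conjMg conjVg; exact: CF.
move=> _ [a [b [Aa Bb ->]]] /=; apply: CAB; exists (a ^ y), (b ^ y).
by split; [exact: nA|exact: nB|rewrite conjRg].
Qed.

Lemma setT_subgroup : is_subgroup [set: G]. Proof. by []. Qed.

Lemma setT_normal : is_normal_in [set: G] [set: G]. Proof. by []. Qed.

Definition second_derived : normal_subgroup G :=
  let nG' := commutator_normal setT_normal setT_normal in
  @NormalSubgroup G (derived (derived [set: G]))
    (commutator_subgroup _ _) (commutator_normal nG' nG').

Lemma lower_central_subgroup i : is_subgroup (lower_central [set: G] i).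
Proof.
by case: i => [//|[//|i]]; rewrite /lower_central /=; exact: commutator_subgroup.
Qed.

Lemma lower_central_normal i :
  is_normal_in (lower_central [set: G] i) [set: G].
Proof.
rewrite /lower_central; elim: i.-1 => //= j nj.
exact/commutator_normal/setT_normal.
Qed.

Definition lower_central_ns (i : nat) : normal_subgroup G :=
  NormalSubgroup (lower_central_subgroup i) (lower_central_normal i).

End Commutators.

(* The map G / N -> H / M induced by phi, when phi maps N into M.            *)
Definition induced_map (G H : groupType) (N : normal_subgroup G)
    (M : normal_subgroup H) (phi : G -> H) (u : quotient N) : quotient M :=
  \pi_(quotient M) (phi (repr u)).

Section Induced.
Variables (G H : groupType) (phi : UMagmaMorphism.type G H).

Lemma induced_mapE (N : normal_subgroup G) (M : normal_subgroup H) :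
  (forall x, nset N x -> nset M (phi x)) ->
  forall x, @induced_map _ _ N M phi (\pi_(quotient N) x) =
            \pi_(quotient M) (phi x).
Proof.
move=> NM x; apply/eqP; rewrite eq_sym; apply/quotientP.
by rewrite -gmulfV -gmulfM; exact/NM/quotient_repr.
Qed.

Lemma lower_central_map i x :
  lower_central [set: G] i x -> lower_central [set: H] i (phi x).
Proof.
rewrite /lower_central; elim: i.-1 x => //= j IH x Gx C [[C1 CF] CP].
apply: (Gx (phi @^-1` C)); split.
  split=> [|u v /= Cu Cv]; first by rewrite /= gmulf1.
  by rewrite gmulfF; exact: CF.
move=> _ [a [b [Aa _ ->]]] /=; apply: CP; exists (phi a), (phi b).
by split=> //; [exact: IH|rewrite gmulfR].
Qed.

Lemma induced_map_lower_central i x :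
  @induced_map _ _ (lower_central_ns G i) (lower_central_ns H i) phi
    (\pi_(quotient (lower_central_ns G i)) x) =
  \pi_(quotient (lower_central_ns H i)) (phi x).
Proof. exact/induced_mapE/lower_central_map. Qed.

Lemma induced_map_lower_central_mul i :
  {morph @induced_map _ _ (lower_central_ns G i) (lower_central_ns H i) phi :
    u v / u * v}.
Proof.
pose Q := quotient (lower_central_ns G i).
elim/(@quotW _ Q) => x; elim/(@quotW _ Q) => y.
rewrite [_ * _]quotient_mulE !induced_map_lower_central gmulfM.
by rewrite [RHS]quotient_mulE.
Qed.

End Induced.

(* The induced maps are homomorphisms by induced_map_lower_central_mul, so   *)
(* that they are isomorphisms if and only if they are bijective.             *)
Definition para (G H : groupType) (phi : UMagmaMorphism.type G H) : Prop :=
  injective phi /\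
  forall i, (1 <= i)%N ->
    bijective (@induced_map _ _ (lower_central_ns G i) (lower_central_ns H i) phi).

(* Main.v *)
(* Identify G with its image in H, and put N = H', K = G'.  Let Z be H'' in  *)
(* case (i) and Z_{c-1}(N) in case (ii); in both cases Z / N' is finite and  *)
(* H / Z is residually nilpotent: for Z_{c-1}(N) because, if w is in         *)
(* gamma_i(H) Z_{j+1}(N) for all i and y is in N, then [w, y] is in          *)
(* gamma_i(H) Z_j(N) for all i.  The abelian group A = N / Z is a module     *)
(* over Z[H/H'] with augmentation ideal I, and H = G gamma_3(H) gives        *)
(* N = K gamma_3(H), that is A = B + I A with B the image of K.  By          *)
(* Nakayama's lemma (1 - a) A <= B for some a in I.  If x = a x then x is in *)
(* I^k A for all k, so 1 - a is injective on A.  Hence (1 - a) A has finite  *)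
(* index in A: otherwise A > (1 - a) A > (1 - a)^2 A > ... is an infinite    *)
(* chain of subgroups, each of infinite index in the previous one.  So K Z,  *)
(* and then K N', have finite index in N; as N is nilpotent, K has finite    *)
(* index in N, and so has G in H.                                            *)

From HB Require Import structures.
Require Import Defs.
From mathcomp Require Import all_boot all_classical.

Set Implicit Arguments.
Unset Strict Implicit.
Unset Printing Implicit Defensive.

Local Open Scope classical_set_scope.
Local Open Scope group_scope.
Local Open Scope quotient_scope.

(** It suffices that the image of [G] has finite index in [H] ([hirsch_length_finite_index]). As [H]
    is the product of that image and [N = H'], it suffices that the image [K] of [G'] has finite
    index in [N]. In a polycyclic group this holds once every element of [N] has a positive power in
    [K] ([finite_index_of_powers]), so the argument is about powers.

    Modulo [Z] the group [N] is abelian, and [para_derived_split] shows that it is the image of [K]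
    plus the augmentation ideal times itself. [nakayama] gives [a] in the ideal such that [1 - a]
    maps into the image of [K]. Residual nilpotence of [H/Z] makes [1 - a] injective, so its image
    has finite index ([injective_endomorphism_finite_index]). Hence elements of [N] have powers in
    [K Z] ([para_power_modulo]), then in [K N'] since [Z/N'] is finite, and [nilpotent_power]
    descends the lower central series of [N] from there to [K].

    Hirsch length is treated as the greatest length of a chain of subgroups, each of infinite index
    in the previous one ([hirsch_lengthP]). *)

Section Subgroups.
Variable G : groupType.
Implicit Types A B C X Y : set G.

Lemma subgroup1 A : is_subgroup A -> A 1. Proof. by case. Qed.

Lemma subgroupV A x : is_subgroup A -> A x -> A x^-1.
Proof. by move=> [A1 AF] Ax; rewrite -div1g; exact: AF. Qed.

Lemma subgroupM A x y : is_subgroup A -> A x -> A y -> A (x * y).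
Proof.
by move=> sA Ax Ay; rewrite -(invgK y); apply: sA.2 => //; exact: subgroupV.
Qed.

Lemma subgroupX A x n : is_subgroup A -> A x -> A (x ^+ n).
Proof.
move=> sA Ax; elim: n => [|n IH]; first exact: subgroup1.
by rewrite expgS; exact: subgroupM.
Qed.

Lemma subgroupJ A x y : is_subgroup A -> A x -> A y -> A (x ^ y).
Proof.
move=> sA Ax Ay; rewrite conjgE.
by do !apply: subgroupM => //; exact: subgroupV.
Qed.

Lemma subgroup_invV A x : is_subgroup A -> A x^-1 -> A x.
Proof. by move=> sA /(subgroupV sA); rewrite invgK. Qed.

Lemma subgroupI A B : is_subgroup A -> is_subgroup B -> is_subgroup (A `&` B).
Proof.
move=> sA sB; split=> [|x y [Ax Bx] [Ay By]]; first by split; exact: subgroup1.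
by split; [exact: sA.2|exact: sB.2].
Qed.

Lemma commutator_gen A B x y : A x -> B y -> commutator A B [~ x, y].
Proof. by move=> Ax By C [_]; apply; exists x, y. Qed.

Lemma commutator_min A B C : is_subgroup C ->
  (forall x y, A x -> B y -> C [~ x, y]) -> commutator A B `<=` C.
Proof.
by move=> sC AB z; apply; split=> // _ [x [y [Ax By ->]]]; exact: AB.
Qed.

Lemma commutator_subl A B :
  is_normal_in A [set: G] -> is_subgroup A -> commutator A B `<=` A.
Proof.
move=> nA sA; apply: commutator_min => // x y Ax _.
by rewrite commgEl; apply: subgroupM => //; [exact: subgroupV|exact: nA.2].
Qed.

Lemma coset_exp A B x y n : is_subgroup B -> is_normal_in B A -> A x ->
  B (x^-1 * y) -> B ((x ^+ n)^-1 * y ^+ n).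
Proof.
move=> sB nB Ax Bxy; elim: n => [|n IH].
  by rewrite !expg0 invg1 mulg1; exact: subgroup1.
have -> : (x ^+ n.+1)^-1 * y ^+ n.+1 = ((x ^+ n)^-1 * y ^+ n) ^ x * (x^-1 * y).
  by rewrite !expgSr conjgE invgM !mulgA mulgK.
by apply: subgroupM => //; exact: nB.2.
Qed.

End Subgroups.

(** * Finite index *)

Section FiniteIndex.
Variable G : groupType.
Implicit Types A B C X Y : set G.

(* For a subgroup [B] this is [finite_index A B] (see [finite_indexP]), but   *)
(* it restricts to subsets of [A] without a choice of coset representatives. *)
Definition coset_coloring A B := exists (T : finType) (f : G -> T),
  forall x y, A x -> A y -> f x = f y -> B (x^-1 * y).

Lemma left_coset_eq B x y : is_subgroup B ->
  left_coset x B = left_coset y B <-> B (x^-1 * y).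
Proof.
move=> sB; split=> [e|Bxy].
  have : left_coset x B y.
    by rewrite e; exists 1; rewrite ?mulg1 //; exact: subgroup1.
  by move=> [b Bb <-]; rewrite mulKg.
apply/seteqP; split=> _ [b Bb <-].
  exists ((x^-1 * y)^-1 * b); last by rewrite invgM invgK !mulgA mulgV mul1g.
  by apply: subgroupM => //; exact: subgroupV.
by exists (x^-1 * y * b); [exact: subgroupM|rewrite !mulgA mulgV mul1g].
Qed.

Lemma finite_indexP A B : is_subgroup B ->
  finite_index A B <-> coset_coloring A B.
Proof.
move=> sB; split=> [/finite_seqP[s es]|[T [f fP]]].
  pose f x := [ffun i : 'I_(size s) => `[< left_coset x B = nth set0 s i >]].
  exists {ffun 'I_(size s) -> bool}, f => x y Ax Ay /ffunP fxy.
  have : (left_coset x B) \in s.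
    by have : [set` s] (left_coset x B) by rewrite -es; exists x.
  move=> /(nthP set0)[i si ei]; have := fxy (Ordinal si).
  rewrite !ffunE ei asboolT //= => /esym/asboolP/esym e.
  exact/left_coset_eq.
pose g (t : T) := left_coset (xget 1 [set x | A x /\ f x = t]) B.
apply: (@sub_finite_set _ _ (range g)); last exact/finite_image/finite_finset.
move=> _ [x Ax <-]; exists (f x) => //; rewrite /g.
case: xgetP => [y _ [Ay fy]|/(_ x)]; last by case.
by apply/left_coset_eq => //; exact: fP.
Qed.

Lemma coset_coloring_sub A B X Y :
  X `<=` A -> B `<=` Y -> coset_coloring A B -> coset_coloring X Y.
Proof.
by move=> XA BY [T [f fP]]; exists T, f => x y /XA Ax /XA Ay /(fP _ _ Ax Ay)/BY.
Qed.

Lemma coset_coloring_refl A B : is_subgroup A -> A `<=` B -> coset_coloring A B.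
Proof.
move=> sA AB; exists unit, (fun=> tt) => x y Ax Ay _; apply: AB.
by apply: subgroupM => //; exact: subgroupV.
Qed.

Lemma coset_coloringI A B X : is_subgroup X -> X `<=` A ->
  coset_coloring A B -> coset_coloring X (X `&` B).
Proof.
move=> sX XA [T [f fP]]; exists T, f => x y Xx Xy fxy; split.
  by apply: subgroupM => //; exact: subgroupV.
by apply: fP => //; exact: XA.
Qed.

(** Write [x] as [r x] times an element of [B], where [r x] depends only on the colour of [x]; the
    colours of [x] and of that element fix the coset modulo [C]. *)
Lemma coset_coloring_trans A B C :
  coset_coloring A B -> coset_coloring B C -> coset_coloring A C.
Proof.
move=> [T [f fP]] [U [g gP]].
pose r x := xget 1 [set y | A y /\ f y = f x].
have rP x : A x -> A (r x) /\ f (r x) = f x.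
  by move=> Ax; rewrite /r; case: xgetP => [y _ []|/(_ x)] //; case.
exists (T * U)%type, (fun x => (f x, g ((r x)^-1 * x))) => x y Ax Ay [fxy].
have -> : r y = r x by rewrite /r fxy.
have [Ar fr] := rP _ Ax.
move/gP; rewrite invgM invgK -!mulgA mulVKg; apply; first exact: fP.
by apply: fP => //; rewrite fr.
Qed.

Lemma coset_coloring_power A B : is_subgroup A -> coset_coloring A B ->
  forall x, A x -> exists2 m, (0 < m)%N & B (x ^+ m).
Proof.
move=> sA [T [f fP]] x Ax; pose F (i : 'I_#|T|.+1) := f (x ^+ i).
have /injectivePn[i [j ij Fij]] : ~~ injectiveb F.
  apply/negP => /injectiveP/leq_card; by rewrite card_ord ltnn.
wlog lij : i j ij Fij / (i < j)%N.
  move=> wl; case: (ltngtP i j) => h; first exact: (wl i j).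
    by apply: (wl j i); rewrite // eq_sym.
  by move: ij; rewrite -val_eqE /= h eqxx.
exists (j - i)%N; first by rewrite subn_gt0.
have := fP _ _ (subgroupX i sA Ax) (subgroupX j sA Ax) Fij.
by rewrite -{1}(subnKC (ltnW lij)) expgnDr mulKg.
Qed.

(** Modulo [B] each element is [a ^+ n] or its inverse; the sign and [n] modulo [k] determine the
    coset. *)
Lemma cyclic_coset_coloring A B a k : is_subgroup A -> is_subgroup B ->
  A a -> (0 < k)%N -> B (a ^+ k) ->
  (forall x, A x -> exists n, B ((a ^+ n)^-1 * x) \/ B (a ^+ n * x)) ->
  coset_coloring A B.
Proof.
move=> sA sB Aa k0 Bk gen.
pose P x (p : nat * bool) := B ((if p.2 then (a ^+ p.1)^-1 else a ^+ p.1) * x).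
have exP x : A x -> exists p, P x p.
  by move=> /gen[n [h|h]]; [exists (n, true)|exists (n, false)].
pose p x := xget (0%N, true) [set p | P x p].
have pP x : A x -> P x (p x).
  by move=> /exP[q Pq]; rewrite /p; case: xgetP => [? _ //|/(_ q)].
exists ('I_k * bool)%type, (fun x => (Ordinal (ltn_pmod (p x).1 k0), (p x).2)).
move=> x y Ax Ay [e1 e2]; move: (pP _ Ax) (pP _ Ay); rewrite /P e2.
move: (p x).1 (p y).1 (p y).2 e1 => {e2} m n b /= e.
wlog lmn : x y Ax Ay m n e / (m <= n)%N.
  move=> wl; case: (leqP m n) => [h|/ltnW h] Bx By.
    exact: (wl x y Ax Ay m n e h Bx By).
  apply: subgroup_invV => //; rewrite invgM invgK.
  exact: (wl y x Ay Ax n m (esym e) h By Bx).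
have [q en] : exists q, n = (m + k * q)%N.
  exists ((n - m) %/ k)%N; rewrite mulnC divnK ?subnKC //.
  by rewrite -eqn_mod_dvd // e eqxx.
have Bq : B (a ^+ (k * q)) by rewrite expgnA; exact: subgroupX.
case: b => Bx By.
  have -> : x^-1 * y =
      ((a ^+ m)^-1 * x)^-1 * (a ^+ (k * q) * ((a ^+ n)^-1 * y)).
    by rewrite en expgnDr !invgM !invgK -!mulgA !mulVKg.
  by apply: subgroupM => //; [exact: subgroupV|exact: subgroupM].
have -> : x^-1 * y = (a ^+ m * x)^-1 * ((a ^+ (k * q))^-1 * (a ^+ n * y)).
  by rewrite en addnC expgnDr !invgM -!mulgA !mulKg.
apply: subgroupM => //; first exact: subgroupV.
by apply: subgroupM => //; exact: subgroupV.
Qed.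

End FiniteIndex.

(** * Hirsch length as the maximal length of an infinite-index chain *)

Section HirschLength.
Variable G : groupType.
Implicit Types A B X Y W : set G.

Lemma cyclic_factor_generator A B : is_subgroup B -> cyclic_factor A B ->
  exists2 a, A a & forall x, A x ->
    exists n, B ((a ^+ n)^-1 * x) \/ B (a ^+ n * x).
Proof.
move=> sB [a Aa gen]; exists a => // x /gen[n [|] /esym /left_coset_eq h].
  by exists n; left; exact: h.
by exists n; right; rewrite -[a ^+ n]invgK; exact: h.
Qed.

(** A nontrivial subgroup of a cyclic group has finite index: [y] is [a ^+ n] or its inverse modulo
    [B], with [n > 0], so [W] contains [a ^+ n]. *)
Lemma cyclic_factor_coloring A B W :
  is_subgroup A -> is_subgroup B -> is_subgroup W -> cyclic_factor A B ->
  B `<=` W -> forall y, A y -> W y -> ~ B y -> coset_coloring A W.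
Proof.
move=> sA sB sW /(cyclic_factor_generator sB)[a Aa gen] BW y Ay Wy nBy.
have [n hn] := gen _ Ay.
have n0 : (0 < n)%N.
  case: n hn => // -[]; by rewrite expg0 ?invg1 mul1g.
apply: (@cyclic_coset_coloring _ _ _ a n) => //.
  case: hn => [/BW h|/BW h].
    apply: subgroup_invV => //; rewrite -(mulgK y (a ^+ n)^-1).
    by apply: subgroupM => //; exact: subgroupV.
  by rewrite -(mulgK y (a ^+ n)); apply: subgroupM => //; exact: subgroupV.
by move=> x /gen[k h]; exists k; case: h => /BW; [left|right].
Qed.

Lemma cyclic_factor_torsion A B :
  is_subgroup A -> is_subgroup B -> is_normal_in B A -> cyclic_factor A B ->
  forall y m, A y -> ~ B y -> (0 < m)%N -> B (y ^+ m) -> coset_coloring A B.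
Proof.
move=> sA sB nB /(cyclic_factor_generator sB)[a Aa gen] y m Ay nBy m0 Bym.
have [n hn] := gen _ Ay.
have n0 : (0 < n)%N.
  case: n hn => // -[]; by rewrite expg0 ?invg1 mul1g.
apply: (@cyclic_coset_coloring _ _ _ a (n * m)%N) => //.
  by rewrite muln_gt0 n0.
have Aan : A (a ^+ n) by exact: subgroupX.
rewrite expgnA; case: hn => h.
  have := coset_exp m sB nB Aan h.
  move/(fun h => subgroupM sB h (subgroupV sB Bym)); rewrite mulgK.
  exact: subgroup_invV.
have h' : B ((a ^- n)^-1 * y) by rewrite invgK.
have := coset_exp m sB nB (subgroupV sA Aan) h'.
move/(fun h => subgroupM sB h (subgroupV sB Bym)); rewrite mulgK.
by rewrite expVgn invgK.
Qed.

(** The set is the product [B Y]. *)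
Lemma prod_subgroup A B Y : is_subgroup A -> is_subgroup B ->
  is_normal_in B A -> is_subgroup Y -> Y `<=` A ->
  is_subgroup [set x | A x /\ exists2 z, Y z & B (x * z^-1)].
Proof.
move=> sA sB [BA nB] sY YA; split.
  split; first exact: subgroup1.
  by exists 1; rewrite ?divg1; exact: subgroup1.
move=> x x' [Ax [z Yz xz]] [Ax' [z' Yz' xz']]; split; first exact: sA.2.
exists (z / z'); first exact: sY.2.
have -> : x / x' / (z / z') = (x / z) * ((x' / z')^-1) ^ (x' / z).
  by rewrite conjgE !invgF !mulgA !mulgVK.
apply: subgroupM => //; apply: nB; first exact: subgroupV.
by apply: sA.2 => //; exact: YA.
Qed.

(** * Subgroups traced along a polycyclic series *)

Section Series.
Variables (n : nat) (s : nat -> set G).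
Hypothesis ss : polycyclic_series n s.

Lemma series_subgroup i : (i <= n)%N -> is_subgroup (s i).
Proof. by case: ss => _ _ + _; exact. Qed.

(** [X] and [Y] are compared inside [s i], from the trivial end upwards. Where the factor of [X] is
    infinite, so is that of [Y]; then [Y] meets the cyclic factor nontrivially and [W], the product
    of [Y] within [s i] and [s i.+1], has finite index in [s i]. *)
Lemma finite_index_of_factors X Y : is_subgroup X -> is_subgroup Y ->
  Y `<=` X ->
  (forall i, (i < n)%N -> coset_coloring (Y `&` s i) (Y `&` s i.+1) ->
     coset_coloring (X `&` s i) (X `&` s i.+1)) ->
  coset_coloring X Y.
Proof.
move=> sX sY YX XY.
have sXY i : (i <= n)%N -> is_subgroup (X `&` s i) /\ is_subgroup (Y `&` s i).
  by move=> lin; split; apply: subgroupI => //; exact: series_subgroup.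
suff h j i : (i + j = n)%N -> coset_coloring (X `&` s i) (Y `&` s i).
  by have := h n 0%N erefl; case: ss => -> _ _ _; rewrite !setIT.
elim: j i => [i|j IH i eij].
  rewrite addn0 => ->; apply: coset_coloring_refl; first by case: (sXY n).
  by case: ss => _ -> _ _ x [_ ->]; split=> //; exact: subgroup1.
have lin : (i < n)%N by rewrite -eij addnS ltnS leq_addr.
have {IH} IH : coset_coloring (X `&` s i.+1) (Y `&` s i.+1).
  by apply: IH; rewrite addSn -addnS.
case: ss => _ _ sub /(_ _ lin)[[si1 nsi] cyc].
have [si si'] := (sub _ (ltnW lin), sub _ lin).
have [|infX] := pselect (coset_coloring (X `&` s i) (X `&` s i.+1)).
  move=> /coset_coloring_trans/(_ IH); apply: coset_coloring_sub => //.
  exact: setIS.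
have infY := contra_not (XY _ lin) infX.
have [y [Yy iy] ny] : exists2 y, (Y `&` s i) y & ~ s i.+1 y.
  apply: contrapT => no; apply: infY.
  apply: coset_coloring_refl; first by case: (sXY _ (ltnW lin)).
  move=> y Yiy; split; first by case: Yiy.
  by apply: contrapT => ny; apply: no; exists y.
pose W := [set x | s i x /\ exists2 z, (Y `&` s i) z & s i.+1 (x * z^-1)].
have sW : is_subgroup W.
  apply: prod_subgroup si si' (conj si1 nsi) (sXY _ (ltnW lin)).2 _.
  exact: subIsetr.
have /(coset_coloringI (proj1 (sXY _ (ltnW lin))) (@subIsetr _ _ _)) :
    coset_coloring (s i) W.
  apply: (@cyclic_factor_coloring _ _ _ _ _ _ cyc _ y) => //.
    move=> x i1x; split; first exact: si1.
    by exists 1; [split; exact: subgroup1|rewrite divg1].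
  by split=> //; exists y; rewrite ?mulgV //; exact: subgroup1.
move=> /coset_coloring_trans; apply.
case: IH => T [f fP].
(* An element of [X] in [W] is an element of [X] in [s i.+1] times some [r x] in [Y]; the colour of
   the first factor fixes the coset modulo [Y]. *)
pose r x := xget 1 [set z | (Y `&` s i) z /\ s i.+1 (x * z^-1)].
exists T, (fun x => f (x * (r x)^-1)).
have rP x : (X `&` s i `&` W) x ->
    [/\ Y (r x), s i (r x) & (X `&` s i.+1) (x * (r x)^-1)].
  move=> [[Xx _] [_ [z Yz xz]]]; rewrite /r.
  case: xgetP => [z' _ [[Yz' iz'] xz']|/(_ z) []//].
  split=> //; split=> //; apply: sX.2 => //; exact: YX.
move=> x x' /rP[Yx ix h] /rP[Yx' ix' h'] /(fP _ _ h h')[].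
move: (r x) (r x') Yx ix Yx' ix' => z z' Yz iz Yz' iz' Yzz izz.
have -> : x^-1 * x' = z^-1 * ((x / z)^-1 * (x' / z')) * z'.
  by rewrite invgF !mulgA mulVg mul1g mulgVK.
have [_ sYi] := sXY _ (ltnW lin).
apply: subgroupM => //; apply: subgroupM => //; first exact: subgroupV.
by split=> //; exact: si1.
Qed.

(** The Hirsch length of [X], read off the traces of [s] on [X]. *)
Definition rank_along X :=
  (\sum_(i < n) `[< ~ coset_coloring (X `&` s i) (X `&` s i.+1) >])%N.

Lemma rank_along_lt X Y : is_subgroup X -> is_subgroup Y -> Y `<=` X ->
  ~ coset_coloring X Y -> (rank_along Y < rank_along X)%N.
Proof.
move=> sX sY YX infXY.
have le (i : 'I_n) :
    (`[< ~ coset_coloring (Y `&` s i) (Y `&` s i.+1) >] <=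
     `[< ~ coset_coloring (X `&` s i) (X `&` s i.+1) >])%N.
  case: asboolP => // infY; case: asboolP => // /contrapT fX; case: infY.
  have sYi : is_subgroup (Y `&` s i).
    by apply: subgroupI => //; exact/series_subgroup/ltnW.
  have := coset_coloringI sYi (@setSI _ (s i) _ _ YX) fX.
  by apply: coset_coloring_sub => // x [[]] ? ? [].
rewrite ltn_neqAle leq_sum ?andbT; last by move=> i _.
apply/eqP => e; apply: infXY; apply: finite_index_of_factors => // i lin fY.
(* Equal sums of termwise comparable summands agree term by term. *)
have := leqif_sum (fun (i : 'I_n) (_ : true) => leqif_eq (le i)).
move=> /leqifP; rewrite -/(rank_along Y) -/(rank_along X) e ltnn.
case: ifP => // /forallP/(_ (Ordinal lin))/eqP/= + _.
by rewrite asboolF ?notK//; case: asboolP => // /contrapT.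
Qed.

(** No series and no normality are involved, so chains can be carried along homomorphisms. *)
Fixpoint infinite_chain X m : Prop :=
  if m is m'.+1 then exists Y, [/\ is_subgroup Y, Y `<=` X,
    ~ coset_coloring X Y & infinite_chain Y m'] else True.

Lemma infinite_chain_rank X m : is_subgroup X ->
  infinite_chain X m -> (m <= rank_along X)%N.
Proof.
elim: m X => // m IH X sX [Y [sY YX infXY /(IH _ sY)]] le.
exact/(leq_ltn_trans le)/rank_along_lt.
Qed.

Lemma rank_alongT : rank_along [set: G] = infinite_factors n s.
Proof.
apply: eq_bigr => i _; rewrite !setTI; congr (nat_of_bool _).
apply/asbool_equiv_eq; rewrite finite_indexP //.
exact: series_subgroup.
Qed.

Lemma infinite_chain_sub X X' m : X `<=` X' ->
  infinite_chain X m -> infinite_chain X' m.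
Proof.
case: m => // m XX' [Y [sY YX infXY c]]; exists Y; split=> //.
  exact: subset_trans XX'.
by apply: contra_not infXY; exact: coset_coloring_sub.
Qed.

Lemma infinite_chain_series : infinite_chain [set: G] (infinite_factors n s).
Proof.
suff h j i : (i + j = n)%N -> infinite_chain (s i)
    (\sum_(i <= k < n) `[< ~ finite_index (s k) (s k.+1) >]).
  by have := h n 0%N erefl; rewrite big_mkord; case: ss => -> _ _.
elim: j i => [i|j IH i eij].
  by rewrite addn0 => ->; rewrite big_geq.
have lin : (i < n)%N by rewrite -eij addnS ltnS leq_addr.
have {IH} IH := IH i.+1; rewrite addSn -addnS in IH.
case: ss => _ _ sub /(_ _ lin)[[si1 nsi] cyc].
rewrite big_ltn //; case: asboolP => inf /=.
  exists (s i.+1); split=> //; [exact: sub| |exact: IH].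
  by move/finite_indexP => h; apply/inf/h/sub.
by rewrite add0n; exact/(infinite_chain_sub si1)/IH.
Qed.

(** Where [Y] has a finite factor, any [y] of [X] in [s i] has a power in [Y], and a further power
    falls into [s i.+1]; a nontrivial torsion element makes the cyclic factor finite. *)
Lemma finite_index_of_powers X Y : is_subgroup X -> is_subgroup Y ->
  Y `<=` X -> (forall x, X x -> exists2 m, (0 < m)%N & Y (x ^+ m)) ->
  coset_coloring X Y.
Proof.
move=> sX sY YX pow; apply: finite_index_of_factors => // i lin fY.
case: ss => _ _ sub /(_ _ lin)[nsi cyc].
have [si si'] := (sub _ (ltnW lin), sub _ lin).
apply: contrapT => infX.
have [y [Xy iy] ny] : exists2 y, (X `&` s i) y & ~ s i.+1 y.
  apply: contrapT => no; apply: infX.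
  apply: coset_coloring_refl; first exact: subgroupI.
  move=> y Xiy; split; first by case: Xiy.
  by apply: contrapT => ny; apply: no; exists y.
have [m m0 Yym] := pow _ Xy.
have [k k0 [_ ymk]] := coset_coloring_power (subgroupI sY si) fY
  (conj Yym (subgroupX m si iy)).
apply: infX.
have := cyclic_factor_torsion si si' nsi cyc iy ny (m := (m * k)%N).
rewrite muln_gt0 m0 k0 expgnA => /(_ isT ymk).
move/(coset_coloringI (subgroupI sX si) (@subIsetr _ _ _)).
by apply: coset_coloring_sub => // x [[]].
Qed.

Lemma smallest_subgroup A : is_subgroup (smallest (@is_subgroup G) A).
Proof.
split=> [C [[C1 _] _] //|x y Ax Ay C CP].
by case: (CP) => -[_ CF] _; apply: CF; [exact: Ax|exact: Ay].
Qed.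

(** If [X] has an element [y] in [s i] outside [s i.+1], then [y] and [s i.+1] generate a subgroup
    of finite index in [s i]. So [y], generators of [X] within [s i.+1] and one representative per
    colour suffice. *)
Lemma subgroup_finitely_generated X : is_subgroup X ->
  exists l : seq G, (forall x, x \in l -> X x) /\
    forall C, is_subgroup C -> (forall x, x \in l -> C x) -> X `<=` C.
Proof.
move=> sX.
suff h j i : (i + j = n)%N -> exists l : seq G,
    (forall x, x \in l -> (X `&` s i) x) /\
    forall C, is_subgroup C -> (forall x, x \in l -> C x) -> X `&` s i `<=` C.
  by have := h n 0%N erefl; case: ss => -> _ _; rewrite !setIT.
elim: j i => [i|j IH i eij].
  rewrite addn0 => ->; exists [::]; split=> // C sC _ x [_].
  by case: ss => _ -> _ _ ->; exact: subgroup1.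
have lin : (i < n)%N by rewrite -eij addnS ltnS leq_addr.
have {IH} [|l [lX lC]] := IH i.+1; first by rewrite addSn -addnS.
case: ss => _ _ sub /(_ _ lin)[nsi cyc].
have [si si'] := (sub _ (ltnW lin), sub _ lin).
have sXi := subgroupI sX si.
have [Xi|nXi] := pselect (X `&` s i `<=` s i.+1).
  exists l; split=> [x /lX[Xx ix]|C sC /(lC C sC) XC x Xix].
    by split=> //; exact: nsi.1.
  by apply: XC; split; [case: Xix|exact: Xi].
have [y [Xiy ny]] : exists y, (X `&` s i) y /\ ~ s i.+1 y.
  apply: contrapT => no; apply: nXi => y Xiy.
  by apply: contrapT => ny; apply: no; exists y.
pose Y := smallest (@is_subgroup G) [set y].
have YC C : is_subgroup C -> C y -> Y `<=` C.
  by move=> sC Cy z; apply; split=> // _ ->.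
have Yy : Y y by move=> C [_]; apply.
have [T [f fP]] : coset_coloring (s i)
    [set x | s i x /\ exists2 z, Y z & s i.+1 (x * z^-1)].
  have iy : s i y by case: Xiy.
  have Yi := YC _ si iy.
  apply: (@cyclic_factor_coloring _ _ _ _ _ _ cyc _ y) => //.
  - by apply: prod_subgroup => //; exact: smallest_subgroup.
  - move=> x i1x; split; first exact: nsi.1.
    by exists 1; rewrite ?divg1 //; exact: (subgroup1 (smallest_subgroup _)).
  by split=> //; exists y; rewrite ?mulgV //; exact: subgroup1.
(* A colour not attained on [X] within [s i] gets the default 1, still a member of [X]. *)
pose r t := xget 1 [set x | (X `&` s i) x /\ f x = t].
have rX t : (X `&` s i) (r t).
  by rewrite /r; case: xgetP => [x _ []//|_]; exact: subgroup1.
exists (y :: l ++ [seq r t | t <- enum T]); split=> [x|C sC Cl x Xix].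
  rewrite inE mem_cat => /or3P[/eqP->//|/lX[Xx ix]|/mapP[t _ ->]//].
  by split=> //; exact: nsi.1.
have Cr : C (r (f x)).
  by apply: Cl; rewrite inE mem_cat map_f ?mem_enum ?orbT.
have fr : f (r (f x)) = f x.
  by rewrite /r; case: xgetP => [z _ []//|/(_ x)]; case.
have [Xr ir] := rX (f x); have [Xx ix] := Xix.
have [_ [z Yz]] := fP _ _ ir ix fr; set w := _^-1 * x => wz.
have Cw : C w.
  rewrite -(mulgVK z w); apply: subgroupM => //; last first.
    by apply: YC Yz => //; apply: Cl; rewrite mem_head.
  apply: (lC C sC) => [u lu|]; first by apply: Cl; rewrite inE mem_cat lu orbT.
  split=> //; apply: sX.2; last by apply: YC Yz => //; case: Xiy.
  by apply: subgroupM => //; exact: subgroupV.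
by rewrite -(mulVKg (r (f x)) x); exact: subgroupM.
Qed.

End Series.

(** Each series yields a chain as long as its number of infinite factors and bounds all chains by
    that number, so any series picked by [xget] gives the maximum. *)
Lemma hirsch_lengthP : polycyclic G ->
  infinite_chain [set: G] (hirsch_length G) /\
  forall m, infinite_chain [set: G] m -> (m <= hirsch_length G)%N.
Proof.
move=> [n [s ss]]; rewrite /hirsch_length.
case: xgetP => [h _ [n' [s' [ss' ->]]]|/(_ (infinite_factors n s))]; last first.
  by case; exists n, s.
split; first exact: infinite_chain_series.
by move=> m /(infinite_chain_rank ss' (setT_subgroup G)); rewrite rank_alongT.
Qed.

End HirschLength.

(** * Injective images and endomorphisms *)

Section InjectiveImage.
Variables (G H : groupType) (f : G -> H) (N : set G).
Hypotheses (sN : is_subgroup N)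
  (fM : forall x y, N x -> N y -> f (x * y) = f x * f y)
  (fI : forall x y, N x -> N y -> f x = f y -> x = y).

Lemma image_in1 : f 1 = 1.
Proof.
have := fM (subgroup1 sN) (subgroup1 sN).
by rewrite mulg1 -[X in X = _]mulg1 => /mulgI.
Qed.

Lemma image_inV x : N x -> f x^-1 = (f x)^-1.
Proof.
move=> Nx; apply/esym/mulg1_eq; have NxV := subgroupV sN Nx.
by rewrite -fM // mulgV image_in1.
Qed.

Lemma image_in_subgroup X : is_subgroup X -> X `<=` N -> is_subgroup (f @` X).
Proof.
move=> sX XN; split; first by exists 1; [exact: subgroup1|exact: image_in1].
move=> _ _ [x Xx <-] [y Xy <-]; exists (x / y); first exact: sX.2.
rewrite fM ?image_inV //; try exact: XN.
exact/(subgroupV sN)/XN.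
Qed.

Lemma infinite_chain_image X m :
  X `<=` N -> infinite_chain X m -> infinite_chain (f @` X) m.
Proof.
elim: m X => // m IH X XN [Y [sY YX infXY c]].
have YN := subset_trans YX XN.
exists (f @` Y); split;
  [exact: image_in_subgroup|exact: image_subset| |exact: IH].
apply: contra_not infXY => -[T [g gP]]; exists T, (g \o f) => x y Xx Xy e.
have [z Yz] : (f @` Y) ((f x)^-1 * f y); first by apply: gP.
have [Nx Ny] := (XN _ Xx, XN _ Xy); have NxV := subgroupV sN Nx.
rewrite -image_inV // -fM // => /fI <- //; first exact: YN.
exact: subgroupM.
Qed.

End InjectiveImage.

Lemma injective_endomorphism_finite_index (G : groupType) (f : G -> G)
    (N : set G) :
  polycyclic G -> is_subgroup N -> (forall x, N x -> N (f x)) ->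
  (forall x y, N x -> N y -> f (x * y) = f x * f y) ->
  (forall x y, N x -> N y -> f x = f y -> x = y) ->
  coset_coloring N (f @` N).
Proof.
move=> pG sN fN fM fI; apply: contrapT => inf.
have chain m : infinite_chain N m.
  elim: m => // m IH; exists (f @` N); split=> //.
  - exact: (image_in_subgroup sN fM).
  - by move=> _ [x Nx <-]; exact: fN.
  - exact: (infinite_chain_image sN fM fI).
have [_ max] := hirsch_lengthP pG.
have := max _ (infinite_chain_sub (@subsetT _ N) (chain (hirsch_length G).+1)).
by rewrite ltnn.
Qed.

(** * Hirsch length and polycyclicity along homomorphisms *)

Section Transfer.
Variables (G H : groupType) (f : UMagmaMorphism.type G H).

Lemma image_subgroup A : is_subgroup A -> is_subgroup (f @` A).
Proof.
move=> sA; split; first by exists 1; [exact: subgroup1|exact: gmulf1].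
move=> _ _ [x Ax <-] [y Ay <-]; exists (x / y); last exact: gmulfF.
exact: sA.2.
Qed.

Lemma preimage_subgroup A : is_subgroup A -> is_subgroup (f @^-1` A).
Proof.
move=> sA; split=> [|x y Ax Ay]; rewrite /preimage /= ?gmulf1 ?gmulfF.
  exact: subgroup1.
exact: sA.2.
Qed.

(** The part of [X] in the range of [f] has finite index in [X], so finite index between preimages
    would give finite index of [Y] in [X]. *)
Lemma infinite_chain_preimage X m :
  is_subgroup X -> coset_coloring [set: H] (range f) ->
  infinite_chain X m -> infinite_chain (f @^-1` X) m.
Proof.
move=> sX fin; elim: m X sX => // m IH X sX [Y [sY YX infXY c]].
exists (f @^-1` Y); split;
  [exact: preimage_subgroup|exact: preimage_subset| |exact: IH].
apply: contra_not infXY => -[T [g gP]].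
apply: (coset_coloring_trans (coset_coloringI sX (@subsetT _ _) fin)).
pose r y := xget 1 [set x | f x = y].
have rP y : (X `&` range f) y -> f (r y) = y.
  by move=> [_ [x _ fx]]; rewrite /r; case: xgetP => // /(_ x).
exists T, (g \o r) => x y Xx Xy e.
rewrite -(rP _ Xx) -(rP _ Xy) -gmulfV -gmulfM; apply: gP => //.
  by rewrite /preimage /= rP //; case: Xx.
by rewrite /preimage /= rP //; case: Xy.
Qed.

Lemma hirsch_length_finite_index : polycyclic G -> polycyclic H ->
  injective f -> coset_coloring [set: H] (range f) ->
  hirsch_length H = hirsch_length G.
Proof.
move=> /hirsch_lengthP[cG maxG] /hirsch_lengthP[cH maxH] fI fin.
apply/eqP; rewrite eqn_leq; apply/andP; split.
  exact/maxG/(infinite_chain_preimage (setT_subgroup H)).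
apply/maxH/(infinite_chain_sub (@subsetT _ (range f))).
apply: (infinite_chain_image (setT_subgroup G)) cG => //.
  by move=> x y _ _; exact: gmulfM.
by move=> x y _ _ /fI.
Qed.

Lemma image_polycyclic : set_surj [set: G] [set: H] f ->
  polycyclic G -> polycyclic H.
Proof.
move=> fS [n [s [s0 sn sub step]]]; exists n, (fun i => f @` s i); split.
- by rewrite s0; apply/seteqP; split=> // x /fS.
- by rewrite sn image_set1 gmulf1.
- by move=> i /sub; exact: image_subgroup.
move=> i lin; have [[ss ns] [a sa gen]] := step _ lin; split.
  split; first exact: image_subset.
  by move=> _ _ [x sx <-] [y sy <-]; exists (x ^ y); [exact: ns|exact: gmulfJ].
have sB := image_subgroup (sub _ lin).
exists (f a); first by exists a.
have co x y : left_coset x (s i.+1) = left_coset y (s i.+1) ->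
    left_coset (f x) (f @` s i.+1) = left_coset (f y) (f @` s i.+1).
  move=> /left_coset_eq h; apply/left_coset_eq => //.
  by exists (x^-1 * y); [exact/h/sub|rewrite gmulfM gmulfV].
move=> _ [x sx <-]; have [k h] := gen _ sx; exists k.
by case: h => /co; rewrite ?gmulfV gmulfXn; [left|right].
Qed.

End Transfer.

(** * Nakayama's lemma in metabelian groups *)

Section Metabelian.
Variables (H : groupType) (N : set H).
Hypotheses (sN : is_subgroup N) (nN : is_normal_in N [set: H])
  (NR : forall x y, N [~ x, y])
  (abN : forall x y, N x -> N y -> x * y = y * x).
Implicit Types (x y z g : H) (f a b : H -> H) (C K : set H).

Lemma abNACA x y z t : N x -> N y -> N z -> N t ->
  (x * y) * (z * t) = (x * z) * (y * t).
Proof. by move=> Nx Ny Nz Nt; rewrite !mulgA -(mulgA x) (abN Ny Nz) !mulgA. Qed.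

Lemma abNV x y : N x -> N y -> (x * y)^-1 = x^-1 * y^-1.
Proof. by move=> Nx Ny; rewrite (abN Nx Ny) invgM. Qed.

Lemma abNJ x y : N x -> N y -> x ^ y = x.
Proof. by move=> Nx Ny; rewrite conjgE (abN Nx Ny) mulKg. Qed.

Lemma NJ x y : N x -> N (x ^ y). Proof. by move=> Nx; exact: nN.2. Qed.

(* [N] is a module over the integral group ring of the abelianisation of [H]; *)
(* these are the operators on [N] given by the augmentation ideal, which is   *)
(* generated by the elements [g - 1].                                         *)
Inductive augmentation : (H -> H) -> Prop :=
| augmentation_comm g : augmentation (fun x => [~ x, g])
| augmentation_mul f f' : augmentation f -> augmentation f' ->
    augmentation (fun x => f x * f' x)
| augmentation_inv f : augmentation f -> augmentation (fun x => (f x)^-1)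
| augmentation_comp f f' : augmentation f -> augmentation f' ->
    augmentation (fun x => f (f' x)).

(** The endomorphisms of [N] as an [H]-module. *)
Definition operator f := [/\ forall x, N x -> N (f x),
  forall x y, N x -> N y -> f (x * y) = f x * f y &
  forall x g, N x -> f (x ^ g) = (f x) ^ g].

Definition normal_sub C := is_subgroup C /\ is_normal_in C [set: H].

Lemma normal_subR C x g : normal_sub C -> C x -> C [~ x, g].
Proof.
move=> [sC nC] Cx; rewrite commgEl; apply: subgroupM => //.
  exact: subgroupV.
exact: nC.2.
Qed.

Lemma augmentation_stable f C x :
  augmentation f -> normal_sub C -> C x -> C (f x).
Proof.
move=> af nC.
elim: af x => [g|f1 f2 _ IH1 _ IH2|f1 _ IH|f1 f2 _ IH1 _ IH2] x Cx.
- exact: normal_subR.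
- by apply: (subgroupM nC.1); [exact: IH1|exact: IH2].
- by apply: (subgroupV nC.1); exact: IH.
- exact/IH1/IH2.
Qed.

(** This will make [1 - a] injective: a fixed point of [a] sinks through the whole lower central
    series. *)
Lemma augmentation_lower_central f i x : augmentation f ->
  lower_central [set: H] i.+1 x -> lower_central [set: H] i.+2 (f x).
Proof.
move=> af; have sub j := lower_central_subgroup H j.
elim: af x => [g|f1 f2 _ IH1 _ IH2|f1 _ IH|f1 f2 a1 _ _ IH2] x Cx.
- exact: commutator_gen.
- by apply: (subgroupM (sub _)); [exact: IH1|exact: IH2].
- by apply: (subgroupV (sub _)); exact: IH.
apply: (@augmentation_stable f1 (lower_central _ i.+2) _ a1); last exact: IH2.
by split; [exact: sub|exact: lower_central_normal].
Qed.

Lemma operator1 f : operator f -> f 1 = 1.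
Proof.
move=> [_ fM _]; have := fM _ _ (subgroup1 sN) (subgroup1 sN).
by rewrite mulg1 -[X in X = _]mulg1 => /mulgI.
Qed.

Lemma operatorV f x : operator f -> N x -> f x^-1 = (f x)^-1.
Proof.
move=> opf Nx; apply/esym/mulg1_eq.
case: (opf) => _ fM _; rewrite -fM //; last exact: (subgroupV sN).
by rewrite mulgV operator1.
Qed.

Lemma operatorR f x g : operator f -> N x -> f [~ x, g] = [~ f x, g].
Proof.
move=> opf Nx; case: (opf) => _ fM fJ.
rewrite commgEl fM ?operatorV ?fJ //; first exact: (subgroupV sN).
exact: NJ.
Qed.

Lemma operator_mul f f' : operator f -> operator f' ->
  operator (fun x => f x * f' x).
Proof.
move=> [fN fM fJ] [fN' fM' fJ']; split=> [x Nx|x y Nx Ny|x g Nx].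
- by apply: (subgroupM sN) => //; [exact: fN|exact: fN'].
- by rewrite fM // fM' // abNACA //; auto.
- by rewrite fJ // fJ' // conjMg.
Qed.

Lemma operator_inv f : operator f -> operator (fun x => (f x)^-1).
Proof.
move=> [fN fM fJ]; split=> [x Nx|x y Nx Ny|x g Nx].
- by apply: (subgroupV sN) => //; exact: fN.
- by rewrite fM // abNV //; exact: fN.
- by rewrite fJ // conjVg.
Qed.

Lemma operator_comp f f' : operator f -> operator f' ->
  operator (fun x => f (f' x)).
Proof.
move=> [fN fM fJ] [fN' fM' fJ']; split=> [x Nx|x y Nx Ny|x g Nx].
- exact/fN/fN'.
- by rewrite fM' // fM //; exact: fN'.
- by rewrite fJ' // fJ //; exact: fN'.
Qed.

Lemma operator_id : operator id. Proof. by split. Qed.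

Lemma augmentation_operator f : augmentation f -> operator f.
Proof.
elim=> [g|f1 f2 _ o1 _ o2|f1 _ o1|f1 f2 _ o1 _ o2]; last 3 first.
- exact: operator_mul.
- exact: operator_inv.
- exact: operator_comp.
split=> [x Nx|x y Nx Ny|x h Nx]; first exact: NR.
  rewrite !commgEl conjMg abNV // abNACA //; try exact: NJ.
    exact: (subgroupV sN).
  exact: (subgroupV sN).
rewrite [RHS]conjRg.
(* [[~ g, h]] lies in [N], hence acts trivially on the abelian group [N]. *)
have -> : g ^ h = g * [~ g, h] by rewrite commgEl mulVKg.
rewrite !commgEl [in RHS]conjgM (abNJ (x := (x ^ h) ^ g)) //.
  by do 2!apply: NJ.
by rewrite -commgEl.
Qed.

Lemma operator_aug_comm f a x : operator f -> augmentation a -> N x ->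
  f (a x) = a (f x).
Proof.
move=> opf aug.
elim: aug x => [g|a1 a2 g1 IH1 g2 IH2|a1 g1 IH|a1 a2 g1 IH1 g2 IH2] x Nx.
- exact: operatorR.
- have [N1 _ _] := augmentation_operator g1.
  have [N2 _ _] := augmentation_operator g2.
  by case: (opf) => fN fM _; rewrite fM ?IH1 ?IH2 //; [exact: N1|exact: N2].
- have [N1 _ _] := augmentation_operator g1.
  by rewrite operatorV ?IH //; exact: N1.
- have [N2 _ _] := augmentation_operator g2.
  by rewrite IH1 ?IH2 //; exact: N2.
Qed.

Lemma operator_one_minus a : augmentation a -> operator (fun x => x * (a x)^-1).
Proof.
move=> /augmentation_operator opa.
exact/(operator_mul operator_id)/operator_inv.
Qed.

(* Induction on the generators [m :: l] of [N] modulo [K], with [K] replaced  *)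
(* by [K' = {y | I y <= J}], where [J = I m + K]: as [m] is in [K'], one has   *)
(* [(1 - a) N <= K'], so [(1 - a) N = (1 - a) I N + (1 - a) K <= J].  Then     *)
(* [(1 - a) m = b m] modulo [K], and [(1 - a - b) (1 - a)] maps [N] into [K].  *)
Lemma nakayama (l : seq H) K :
  (forall x, x \in l -> N x) -> normal_sub K -> K `<=` N ->
  (forall C, normal_sub C -> K `<=` C ->
    (forall x g, N x -> C [~ x, g]) -> N `<=` C) ->
  (forall C, normal_sub C -> K `<=` C -> (forall x, x \in l -> C x) ->
    N `<=` C) ->
  exists2 a, augmentation a & forall x, N x -> K (x * (a x)^-1).
Proof.
elim: l K => [|m l IH] K lN nK KN perf gen.
  have NK : N `<=` K by exact: gen.
  (* The commutator with 1 serves as the zero operator. *)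
  exists (fun x => [~ x, 1]); first exact: augmentation_comm.
  by move=> x /NK; rewrite commg1 divg1.
have Nm : N m by apply: lN; rewrite mem_head.
have ll x : x \in l -> N x by move=> lx; apply: lN; rewrite inE lx orbT.
have opR g := augmentation_operator (augmentation_comm g).
pose J := [set y | N y /\ exists2 b, augmentation b & K (y * (b m)^-1)].
pose K' := [set y | N y /\ forall g, J [~ y, g]].
have JK y : K y -> J y.
  move=> Ky; split; first exact: KN.
  exists (fun x => [~ x, 1]); first exact: augmentation_comm.
  by rewrite commg1 divg1.
have nJ : normal_sub J.
  split; split=> //; first exact/JK/(subgroup1 nK.1).
  - move=> y y' [Ny [b ab Kb]] [Ny' [b' ab' Kb']]; split; first exact: sN.2.
    exists (fun x => b x * (b' x)^-1).
      exact/(augmentation_mul ab)/augmentation_inv.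
    have [bN _ _] := augmentation_operator ab.
    have [bN' _ _] := augmentation_operator ab'.
    have [Nb Nb'] := (bN _ Nm, bN' _ Nm); have sV := subgroupV sN.
    have -> : y / y' * (b m / b' m)^-1 = (y / b m) / (y' / b' m).
      rewrite (abNV Nb (sV _ Nb')) (abNV Ny' (sV _ Nb')).
      by rewrite abNACA //; do ?exact: sV; rewrite invgK.
    exact: nK.1.2.
  - move=> y g [Ny [b ab Kb]] _; split; first exact: NJ.
    exists (fun x => b x * [~ b x, g]).
      exact/(augmentation_mul ab)/(augmentation_comp (augmentation_comm g)).
    by rewrite commgEl mulVKg -conjVg -conjMg; exact: nK.2.2.
have nK' : normal_sub K'.
  split; split=> //.
  - split=> [|g]; first exact: (subgroup1 sN).
    by rewrite comm1g; exact: (subgroup1 nJ.1).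
  - move=> y y' [Ny Jy] [Ny' Jy']; split=> [|g]; first exact: sN.2.
    have [_ oM _] := opR g; rewrite oM //; last exact: subgroupV.
    by rewrite (operatorV (opR g)) //; exact: (nJ.1.2 _ _ (Jy g) (Jy' g)).
  - move=> y g [Ny Jy] _; split=> [|h]; first exact: NJ.
    have [_ _ -> //] := opR h; exact: (nJ.2.2 _ _ (Jy h)).
have KK' : K `<=` K'.
  by move=> y Ky; split=> [|g]; [exact: KN|exact: JK (normal_subR g nK Ky)].
have K'm : K' m.
  split=> // g; split; first exact: NR.
  exists (fun x => [~ x, g]); first exact: augmentation_comm.
  by rewrite mulgV; exact: (subgroup1 nK.1).
have [|C nC K'C|C nC K'C lC|a aa aK'] := IH K' ll nK'.
- by move=> y [].
- by apply: perf => //; exact: subset_trans K'C.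
- apply: gen => //; first exact: subset_trans K'C.
  by move=> x; rewrite inE => /predU1P[->|/lC//]; exact: K'C.
have op1 := operator_one_minus aa; have [NL ML JL] := op1.
pose E := [set x | N x /\ J (x * (a x)^-1)].
(* [E] is the preimage of [J] under [1 - a]. It contains [[~ x, g]] for [x] in [N], since the image
   is the commutator of [(1 - a) x], an element of [K'], with [g]. *)
have NE : N `<=` E.
  apply: perf; first split; first split.
  - split; first exact: (subgroup1 sN).
    by rewrite (operator1 op1); exact: (subgroup1 nJ.1).
  - move=> x y [Nx Jx] [Ny Jy]; split; first exact: sN.2.
    rewrite ML //; last exact: subgroupV.
    by rewrite (operatorV op1) //; exact: (nJ.1.2 _ _ Jx Jy).
  - split=> // x g [Nx Jx] _; split; first exact: NJ.
    by rewrite JL //; exact: (nJ.2.2 _ _ Jx).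
  - move=> y Ky; split; first exact: KN.
    exact/JK/(nK.1.2 _ _ Ky)/(augmentation_stable aa nK Ky).
  - move=> x g Nx; split; first exact: NR.
    by rewrite (operatorR g op1) //; case: (aK' x Nx).
have [_ [_ [b ab Kb]]] := NE _ Nm.
pose a' x := a x * b x.
have aa' : augmentation a' by exact: augmentation_mul.
have op2 := operator_one_minus aa'; have [NL' ML' JL'] := op2.
have [aN aM _] := augmentation_operator aa.
have [aN' aM' _] := augmentation_operator aa'.
have [bN _ _] := augmentation_operator ab.
have Km : K (m * (a' m)^-1).
  by rewrite /a' abNV ?mulgA //; [exact: aN|exact: bN].
(* With [a' = a + b], this is [1 - (1 - a')(1 - a)] expanded. *)
exists (fun x => a x * (a' x * (a' (a x))^-1)).
  apply: augmentation_mul => //; apply: augmentation_mul => //.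
  exact/augmentation_inv/augmentation_comp.
move=> x Nx.
have [_ [_ [c ac Kc]]] := NE _ Nx.
set d := x * (a x)^-1 in Kc.
have Nd : N d by exact: NL.
have [cN _ _] := augmentation_operator ac.
have -> : x * (a x * (a' x * (a' (a x))^-1))^-1 = d * (a' d)^-1.
  rewrite /d aM' //; last exact/(subgroupV sN)/aN.
  rewrite (operatorV (augmentation_operator aa')); last exact: aN.
  rewrite abNV; [by rewrite mulgA|exact: aN|].
  apply: subgroupM => //; [exact: aN'|exact/(subgroupV sN)/aN'/aN].
(* [d = (1 - a) x] is an element of [K] plus [c m]; as operators commute, [1 - a'] sends [c m] to
   [c] applied to [(1 - a') m], which is in [K]. *)
have -> : d = d * (c m)^-1 * c m by rewrite mulgVK.
rewrite ML'; [|exact: KN|exact: cN].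
apply: (subgroupM nK.1).
  exact/(nK.1.2 _ _ Kc)/(augmentation_stable aa' nK Kc).
rewrite -/((fun x => x * (a' x)^-1) (c m)) (operator_aug_comm op2 ac) //.
exact: (augmentation_stable ac nK Km).
Qed.

End Metabelian.

(** * Powers in the derived subgroup of a metabelian group *)

Section MetabelianPower.
Variable H : groupType.
Implicit Types K C : set H.
Let N : set H := derived [set: H].

(** The condition on all [C] says that [N = K + I N], with [I] the augmentation ideal. Nakayama puts
    [(1 - a) N] inside [K]; it has finite index in [N], so it contains a positive power of [x]. *)
Lemma metabelian_power K :
  polycyclic H -> residually_nilpotent H ->
  (forall x y, N x -> N y -> x * y = y * x) ->
  normal_sub K -> K `<=` N ->
  (forall C, normal_sub C -> K `<=` C ->
    (forall x g, N x -> C [~ x, g]) -> N `<=` C) ->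
  forall x, N x -> exists2 m, (0 < m)%N & K (x ^+ m).
Proof.
move=> pH rH abN nK KN perf x Nx.
have sN : is_subgroup N := commutator_subgroup _ _.
have nN : is_normal_in N [set: H] :=
  commutator_normal (setT_normal H) (setT_normal H).
have NR g h : N [~ g, h] by exact: commutator_gen.
have [n [s ss]] := pH.
have [l [lN gen]] := subgroup_finitely_generated ss sN.
have [|a aa aK] := nakayama sN nN NR abN lN nK KN perf.
  by move=> C [sC _] _; exact: gen.
have [fN fM _] := operator_one_minus sN nN NR abN aa.
have op1 := operator_one_minus sN nN NR abN aa.
have fI y z : N y -> N z -> y * (a y)^-1 = z * (a z)^-1 -> y = z.
  move=> Ny Nz e; apply/esym; rewrite -[z]invgK; apply: mulg1_eq.
  have Nw : N (z^-1 * y) by apply: (subgroupM sN) => //; exact: (subgroupV sN).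
  have : z^-1 * y * (a (z^-1 * y))^-1 = 1.
    rewrite fM //; last exact: (subgroupV sN).
    by rewrite (operatorV sN op1) // e mulVg.
  (* The quotient [w] satisfies [w = a w], so it lies in every lower central term. *)
  move: (z^-1 * y) Nw => w Nw {e} /divg1_eq e.
  suff : [set 1] w by [].
  rewrite -rH => -[//|i] _; elim: i => // -[_|i IH]; first exact: Nw.
  by rewrite e; exact: (augmentation_lower_central aa IH).
have fin := injective_endomorphism_finite_index pH sN fN fM fI.
have [m m0 [y Ny eq]] := coset_coloring_power sN fin Nx.
by exists m; rewrite // -eq; exact: aK.
Qed.
End MetabelianPower.

(** * Nilpotent groups *)

Section Projection.
Variables (H : groupType) (Z : normal_subgroup H).

Definition coset_proj (x : H) : quotient Z := \pi_(quotient Z) x.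

Lemma projF : {morph coset_proj : x y / x / y}.
Proof.
move=> x y; rewrite /coset_proj -quotient_mulE; congr (quotient_mul _ _).
exact/esym/quotient_invE.
Qed.

HB.instance Definition _ :=
  isGroupMorphism.Build H (quotient Z) coset_proj projF.

Lemma projP x y : coset_proj x = coset_proj y <-> nset Z (x^-1 * y).
Proof. by split=> [/eqP/quotientP|?] //; apply/eqP/quotientP. Qed.

Lemma proj_eq1 x : coset_proj x = 1 <-> nset Z x.
Proof.
have p1 : coset_proj 1 = 1 by exact: gmulf1.
split=> [e|Zx]; first by rewrite -[x]mul1g -invg1; apply/projP; rewrite e.
by rewrite -p1; apply/esym/projP; rewrite invg1 mul1g.
Qed.

Lemma proj_surj (u : quotient Z) : exists x, coset_proj x = u.
Proof. by exists (repr u); rewrite /coset_proj reprK. Qed.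

Lemma proj_set_surj : set_surj [set: H] [set: quotient Z] coset_proj.
Proof. by move=> u _; have [x] := proj_surj u; exists x. Qed.

Lemma lower_central_proj i :
  lower_central [set: quotient Z] i `<=` coset_proj @` lower_central [set: H] i.
Proof.
rewrite /lower_central; elim: i.-1 => [|j IH] /=; first exact: proj_set_surj.
apply: commutator_min; first exact/image_subgroup/commutator_subgroup.
move=> _ y /IH[a ha <-] _; have [b <-] := proj_surj y.
by exists [~ a, b]; [exact: commutator_gen|exact: gmulfR].
Qed.

Lemma residually_nilpotent_quotient :
  (forall x, (forall i, (1 <= i)%N ->
     exists2 g, lower_central [set: H] i g & nset Z (g^-1 * x)) -> nset Z x) ->
  residually_nilpotent (quotient Z).
Proof.
move=> res; apply/seteqP; split=> [u hu|_ -> i _]; last first.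
  exact: (subgroup1 (lower_central_subgroup _ _)).
have [x xu] := proj_surj u; rewrite -xu; apply/proj_eq1/res => i i1.
have [g hg gu] := lower_central_proj (hu i i1).
by exists g => //; apply/projP; rewrite gu xu.
Qed.

End Projection.

(** * Powers modulo a central subgroup *)

Section CentralPower.
Variables (P : groupType) (N K L0 L : set P).
Hypotheses (sN : is_subgroup N) (sK : is_subgroup K) (sL : is_subgroup L)
  (KN : K `<=` N) (L0N : L0 `<=` N) (LN : L `<=` N)
  (cL : forall u y, L u -> N y -> u * y = y * u)
  (L0R : forall u y, L0 u -> N y -> L [~ u, y])
  (genL : forall D, is_subgroup D ->
     (forall u y, L0 u -> N y -> D [~ u, y]) -> L `<=` D).

Lemma commgX_central (u y : P) m :
  commute [~ u, y] u -> [~ u ^+ m, y] = [~ u, y] ^+ m.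
Proof.
move=> cu; rewrite commgEl conjXg.
have -> : u ^ y = u * [~ u, y] by rewrite commgEl mulVKg.
by rewrite expgMn; [rewrite mulKg|exact: commute_sym].
Qed.

Lemma commgX2_central (u y : P) m n :
  commute [~ u, y] u -> commute [~ u, y] y ->
  [~ u ^+ m, y ^+ n] = [~ u, y] ^+ (m * n).
Proof.
move=> cu cy; rewrite -invgR commgX_central; last first.
  rewrite -invgR commgX_central //.
  by apply/commute_sym/commuteV/commuteX/commute_sym.
by rewrite -[[~ y, _]]invgR commgX_central // expVgn invgK expgnA.
Qed.

Lemma commgM_central k l w w' : N k -> N l -> L w -> L w' ->
  [~ k * w, l * w'] = [~ k, l].
Proof.
move=> Nk Nl Lw Lw'.
have fixN x z : N x -> L z -> x ^ z = x.
  by move=> Nx Lz; rewrite conjgE -(cL Lz Nx) mulKg.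
have fixL z x : L z -> N x -> z ^ x = z.
  by move=> Lz Nx; rewrite conjgE (cL Lz Nx) mulKg.
have Nkl : N (k ^ l) by exact: subgroupJ.
rewrite [LHS]commgEl conjMg (fixL w) //; last exact/(subgroupM sN Nl)/LN.
rewrite conjgM (fixN (k ^ l)) // invgM -mulgA -/(conjg _ w) [_ * (_ * w)]mulgA.
rewrite -conjgE -commgEl fixN //; apply: subgroupM => //; exact: subgroupV.
Qed.

(** If [u ^+ m] and [y ^+ n] are [k] and [l] times elements of the central [L], then [[~ u, y] ^+ (m
    * n) = [~ k, l]] is in [K]. Such commutators generate the abelian group [L], so all of [L] has
    powers in [K]. *)
Lemma central_power :
  (forall x, N x -> exists2 m, (0 < m)%N &
     exists2 k, K k & L (k^-1 * x ^+ m)) ->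
  forall x, N x -> exists2 m, (0 < m)%N & K (x ^+ m).
Proof.
move=> pow.
pose D := [set u | L u /\ exists2 m, (0 < m)%N & K (u ^+ m)].
have LD : L `<=` D.
  apply: genL.
    split; first split; first exact: subgroup1.
      by exists 1%N => //; rewrite expg1n; exact: subgroup1.
    move=> u v [Lu [m m0 Ku]] [Lv [n n0 Kv]]; split; first exact: sL.2.
    exists (m * n)%N; first by rewrite muln_gt0 m0.
    rewrite expgnFl; last by apply: cL => //; exact: LN.
    apply: sK.2; first by rewrite expgnA; exact: subgroupX.
    by rewrite mulnC expgnA; exact: subgroupX.
  move=> u y L0u Ny; have Luy := L0R L0u Ny; split=> //.
  have Nu := L0N L0u.
  have [m m0 [k Kk Lk]] := pow _ Nu; have [n n0 [l Kl Ll]] := pow _ Ny.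
  exists (m * n)%N; first by rewrite muln_gt0 m0.
  rewrite -commgX2_central; [|exact: cL|exact: cL].
  rewrite -(mulVKg k (u ^+ m)) -(mulVKg l (y ^+ n)).
  rewrite commgM_central //; try exact: KN.
  rewrite commgEl; apply: subgroupM => //; [exact: subgroupV|exact: subgroupJ].
move=> x Nx; have [m m0 [k Kk Lk]] := pow _ Nx.
have [_ [n n0 Kn]] := LD _ Lk.
exists (m * n)%N; first by rewrite muln_gt0 m0.
rewrite expgnA -(mulVKg k (x ^+ m)) expgMn; last first.
  by apply/commute_sym/cL => //; exact: KN.
by apply: subgroupM => //; exact: subgroupX.
Qed.

End CentralPower.

(** * Central series and powers in a nilpotent normal subgroup *)

Section NilpotentPower.
Variables (H : groupType) (N : set H).
Hypotheses (sN : is_subgroup N) (nN : is_normal_in N [set: H]).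

Lemma lower_central_in i :
  is_subgroup (lower_central N i) /\ is_normal_in (lower_central N i) [set: H].
Proof.
rewrite /lower_central; elim: i.-1 => [//|j [sj nj]] /=.
by split; [exact: commutator_subgroup|exact: commutator_normal].
Qed.

Lemma lower_centralS i : lower_central N i.+2 `<=` lower_central N i.+1.
Proof. by have [si ni] := lower_central_in i.+1; exact: commutator_subl. Qed.

Lemma lower_central_subset i : lower_central N i.+1 `<=` N.
Proof.
elim: i => [//|i IH]; exact: subset_trans (@lower_centralS i) IH.
Qed.

(** Modulo the term [i.+3], the term [i.+2] is central and generated by commutators of the term
    [i.+1] with [N], so [central_power] removes it. *)
Lemma nilpotent_power c K : (1 <= c)%N -> lower_central N c.+1 = [set 1] ->
  is_subgroup K -> K `<=` N ->
  (forall x, N x -> exists2 m, (0 < m)%N &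
     exists2 k, K k & derived N (k^-1 * x ^+ m)) ->
  forall x, N x -> exists2 m, (0 < m)%N & K (x ^+ m).
Proof.
move=> c1 Nc sK KN pow.
suff h i : forall x, N x -> exists2 m, (0 < m)%N &
     exists2 k, K k & lower_central N i.+2 (k^-1 * x ^+ m).
  move=> x Nx; have [m m0 [k Kk]] := h c.-1 x Nx.
  rewrite prednK // Nc => /mulg1_eq; rewrite invgK => e.
  by exists m; rewrite -?e.
elim: i => // i IH x Nx.
have [s3 n3] := lower_central_in i.+3.
pose Z := NormalSubgroup s3 n3; pose p := coset_proj Z.
suff [m m0 [k Kk]] : exists2 m, (0 < m)%N & (p @` K) (p x ^+ m).
  by rewrite -gmulfXn => /projP h; exists m => //; exists k.
apply: (@central_power _ (p @` N) (p @` K)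
  (p @` lower_central N i.+1) (p @` lower_central N i.+2)).
- exact: image_subgroup.
- exact: image_subgroup.
- by apply: image_subgroup; case: (lower_central_in i.+2).
- exact: image_subset.
- exact/image_subset/lower_central_subset.
- exact/image_subset/lower_central_subset.
- move=> _ _ [u Lu <-] [y Ny <-]; rewrite -!gmulfM; apply/esym/projP.
  have -> : (y * u)^-1 * (u * y) = [~ u, y] by rewrite invgM -!mulgA.
  exact: commutator_gen.
- move=> _ _ [u Lu <-] [y Ny <-]; exists [~ u, y]; last exact: gmulfR.
  exact: commutator_gen.
- move=> D sD gen _ [u Lu <-]; apply: (Lu (p @^-1` D)); split.
    exact: preimage_subgroup.
  move=> _ [v [y [Lv Ny ->]]].
  rewrite /preimage /=; have -> : p [~ v, y] = [~ p v, p y] by exact: gmulfR.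
  by apply: gen; [exists v|exists y].
- move=> _ [y Ny <-]; have [m m0 [k Kk Lk]] := IH _ Ny.
  exists m => //; exists (p k); first by exists k.
  by exists (k^-1 * y ^+ m) => //; rewrite /p gmulfM gmulfV gmulfXn.
- by exists x.
Qed.

Lemma upper_central_in j :
  is_subgroup (upper_central N j) /\ is_normal_in (upper_central N j) [set: H].
Proof.
elim: j => [|j [sj nj]] /=.
  split; first by split=> // x y -> ->; rewrite /= divg1.
  by split=> // x y -> _; rewrite /= conj1g.
split; split=> //.
- by split=> [|y _]; [exact: subgroup1|rewrite comm1g; exact: subgroup1].
- move=> x y [Nx Zx] [Ny Zy]; split=> [|z Nz]; first exact: sN.2.
  have -> : [~ x / y, z] = ([~ x, z] / [~ y, z]) ^ y^-1.
    by rewrite !commgEl !conjgE !invgM !invgK !mulgA !mulgK.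
  apply: nj.2 => //; apply: sj.2; [exact: Zx|exact: Zy].
- move=> x h [Nx Zx] _; split=> [|y Ny]; first exact: nN.2.
  rewrite -[y](conjgKV h) -conjRg; apply: nj.2 => //.
  by apply: Zx; exact: nN.2.
Qed.

Lemma upper_central_subset j : upper_central N j `<=` N.
Proof. by case: j => [|j] x => [->|[]//]; exact: subgroup1. Qed.

Lemma lower_central_upper_central c j : lower_central N c.+1 = [set 1] ->
  (j <= c)%N -> lower_central N (c - j).+1 `<=` upper_central N j.
Proof.
move=> Nc; elim: j => [|j IH] jc; first by rewrite subn0 Nc.
move=> x Lx; split; first exact: lower_central_subset Lx.
move=> y Ny; apply: (IH (ltnW jc)); rewrite subnS in Lx.
have e : (c - j = (c - j).-1.+1)%N by rewrite prednK // subn_gt0.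
rewrite e; exact: commutator_gen.
Qed.

End NilpotentPower.

(** * Para-G groups *)

Section Para.
Variables (G H : groupType) (phi : UMagmaMorphism.type G H).
Hypothesis paraphi : para phi.
Let N : set H := derived [set: H].
Let K : set H := phi @` derived [set: G].

(** Surjectivity of the induced map. *)
Lemma para_lift i y : (1 <= i)%N ->
  exists g, lower_central [set: H] i ((phi g)^-1 * y).
Proof.
move=> i1; have [_ /(_ i i1)[inv _ invK]] := paraphi.
pose u := inv (\pi_(quotient (lower_central_ns H i)) y); exists (repr u).
apply/(@quotientP _ (lower_central_ns H i))/eqP.
by rewrite -[RHS]invK -/u -[u in RHS]reprK induced_map_lower_central.
Qed.

Lemma para_reflect i x : (1 <= i)%N ->
  lower_central [set: H] i (phi x) -> lower_central [set: G] i x.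
Proof.
move=> i1 Hx; have [_ /(_ i i1)/bij_inj inj] := paraphi.
have /eqP/quotientP : \pi_(quotient (lower_central_ns G i)) 1 =
    \pi_(quotient (lower_central_ns G i)) x.
  apply: inj; rewrite !induced_map_lower_central gmulf1.
  by apply/eqP/quotientP; rewrite invg1 mul1g.
by rewrite invg1 mul1g.
Qed.

Let sN : is_subgroup N := commutator_subgroup _ _.
Let nN : is_normal_in N [set: H] :=
  commutator_normal (setT_normal H) (setT_normal H).

Lemma para_derived_sub : K `<=` N.
Proof. by move=> _ [x Gx <-]; exact: (@lower_central_map _ _ phi 2). Qed.

(** Lift [y] modulo the third term; the lift maps into [N], and injectivity at level 2 puts it in
    [G']. *)
Lemma para_derived_split y : N y ->
  exists2 k, K k & lower_central [set: H] 3 (k^-1 * y).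
Proof.
move=> Ny; have [g h3] := @para_lift 3 y isT; exists (phi g) => //.
exists g => //; apply: (@para_reflect 2) => //.
have h2 : N ((phi g)^-1 * y).
  exact: (@commutator_subl _ N [set: H] nN sN).
have -> : phi g = y * ((phi g)^-1 * y)^-1 by rewrite invgM invgK mulVKg.
exact: sN.2.
Qed.

(** * Comparison modulo a subgroup [Z] between [N'] and [N] *)

Section ModuloZ.
Variable Z : normal_subgroup H.
Hypotheses (NZ : derived N `<=` nset Z) (ZN : nset Z `<=` N).

Lemma proj_abelian x y : derived [set: quotient Z] x ->
  derived [set: quotient Z] y -> x * y = y * x.
Proof.
move=> /(@lower_central_proj _ Z 2)[a Na <-].
move=> /(@lower_central_proj _ Z 2)[b Nb <-].
rewrite -!gmulfM; apply/esym/projP/NZ.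
have -> : (b * a)^-1 * (a * b) = [~ a, b] by rewrite invgM -!mulgA.
exact: commutator_gen.
Qed.

(** The image of [G] normalises [K], and [H] is that image times [N], which acts trivially on the
    abelian group [N/Z]. *)
Lemma para_proj_normal : normal_sub (coset_proj Z @` K).
Proof.
have sK : is_subgroup K by apply: image_subgroup; exact: commutator_subgroup.
split; first exact: image_subgroup.
split=> // _ u [_ [k Gk <-] <-] _; have [h <-] := proj_surj u.
have [g h2] := @para_lift 2 h isT.
have Kkg : K (phi (k ^ g)).
  exists (k ^ g) => //.
  exact: (commutator_normal (setT_normal G) (setT_normal G)).2.
exists (phi (k ^ g)) => //.
rewrite -[h](mulVKg (phi g)) [in RHS]gmulfM conjgM -!gmulfJ.
have [Nk Nn] := (para_derived_sub Kkg, h2).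
apply/projP/NZ; rewrite -commgEl; exact: commutator_gen.
Qed.

Lemma para_power_modulo :
  polycyclic H -> residually_nilpotent (quotient Z) ->
  forall x, N x -> exists2 m, (0 < m)%N &
    exists2 k, K k & nset Z (k^-1 * x ^+ m).
Proof.
move=> pH rZ x Nx.
have pZ := image_polycyclic (@proj_set_surj _ Z) pH.
have mapN y : N y -> derived [set: quotient Z] (coset_proj Z y).
  exact: (@lower_central_map _ _ (coset_proj Z) 2).
suff [m m0 [k Kk]] : exists2 m, (0 < m)%N &
    (coset_proj Z @` K) (coset_proj Z x ^+ m).
  by rewrite -gmulfXn => /projP h; exists m => //; exists k.
apply: (metabelian_power pZ rZ proj_abelian para_proj_normal) (mapN _ Nx).
  by move=> _ [k Kk <-]; exact: mapN (para_derived_sub Kk).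
(* [N] is [K] times the third lower central term, which is generated by the commutators of [N] with
   [H]. *)
move=> C [sC nC] KC perf u /(@lower_central_proj _ Z 2)[y Ny <-].
have [k Kk h3] := para_derived_split Ny.
rewrite -[y](mulVKg k) gmulfM; apply: subgroupM => //.
  by apply: KC; exists k.
apply: (h3 (coset_proj Z @^-1` C)); split; first exact: preimage_subgroup.
move=> _ [a [b [Na _ ->]]]; rewrite /preimage /= gmulfR.
exact: (perf _ _ (mapN _ Na)).
Qed.

(** If [x ^+ m = k * z] and [z ^+ n] is in [N'], then [x ^+ (m * n)] is [k ^+ n] modulo [N'], as
    [N/N'] is abelian. *)
Lemma para_power_derived :
  polycyclic H -> residually_nilpotent (quotient Z) ->
  (forall z, nset Z z -> exists2 m, (0 < m)%N & derived N (z ^+ m)) ->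
  forall x, N x -> exists2 m, (0 < m)%N &
    exists2 k, K k & derived N (k^-1 * x ^+ m).
Proof.
move=> pH rZ torZ x Nx.
have [m m0 [k Kk Zz]] := para_power_modulo pH rZ Nx.
have [n n0 Nz] := torZ _ Zz.
have sK : is_subgroup K by apply: image_subgroup; exact: commutator_subgroup.
exists (m * n)%N; first by rewrite muln_gt0 m0.
exists (k ^+ n); first exact: subgroupX.
pose p := coset_proj (second_derived H).
suff e : p (k ^+ n) = p (x ^+ (m * n)) by move/projP: e.
have cp a b : N a -> N b -> commute (p a) (p b).
  move=> Na Nb; rewrite /commute -!gmulfM; apply/esym/projP.
  have -> : (b * a)^-1 * (a * b) = [~ a, b] by rewrite invgM -!mulgA.
  exact: commutator_gen.
rewrite expgnA -(mulVKg k (x ^+ m)); set z := k^-1 * _ in Zz Nz *.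
rewrite /p !gmulfXn gmulfM -/p expgMn; last first.
  by apply: cp; [exact: para_derived_sub|exact: ZN].
have pz : p (z ^+ n) = 1 by apply/proj_eq1.
by rewrite -[p z ^+ n]gmulfXn [X in _ * X]pz mulg1.
Qed.

Lemma para_hirsch_length c : polycyclic G -> polycyclic H -> (1 <= c)%N ->
  lower_central N c.+1 = [set 1] -> residually_nilpotent (quotient Z) ->
  (forall z, nset Z z -> exists2 m, (0 < m)%N & derived N (z ^+ m)) ->
  hirsch_length H = hirsch_length G.
Proof.
move=> pG pH c1 Nc rZ torZ.
have sK : is_subgroup K by apply: image_subgroup; exact: commutator_subgroup.
have pow := nilpotent_power sN nN c1 Nc sK para_derived_sub
  (para_power_derived pH rZ torZ).
have [n [s ss]] := pH.
have [T [f fP]] := finite_index_of_powers ss sN sK para_derived_sub pow.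
have [phiI _] := paraphi.
apply: (hirsch_length_finite_index pG pH phiI).
have sphi : is_subgroup (range phi) by exact: image_subgroup.
(* Every [h] is some [r h] in [N] times an element of the range; the colour of [r h] modulo [K]
   fixes the coset of [h]. *)
pose r h := xget 1 [set a | N a /\ range phi (a^-1 * h)].
have rP h : N (r h) /\ range phi ((r h)^-1 * h).
  rewrite /r; case: xgetP => [a _ []//|].
  have [g h2] := @para_lift 2 h isT.
  move=> /(_ (h * (phi g)^-1)); case; split.
    have -> : h * (phi g)^-1 = ((phi g)^-1 * h) ^ (phi g)^-1.
      by rewrite conjgE invgK mulgA mulVKg.
    exact: nN.2.
  by exists g => //; rewrite invgF mulgVK.
exists T, (f \o r) => x y _ _ e.
have [[Nx xP] [Ny yP]] := (rP x, rP y).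
have [k Gk kE] := fP _ _ Nx Ny e.
have -> : x^-1 * y = ((r x)^-1 * x)^-1 * ((r x)^-1 * r y) * ((r y)^-1 * y).
  by rewrite invgM invgK -!mulgA !mulVKg.
do 2?apply: (subgroupM sphi) => //; first exact: (subgroupV sphi).
by exists k.
Qed.

End ModuloZ.
End Para.

(** Induction on [j]: for [x = g * z] one has [[~ x, y] = [~ g, y] ^ z * [~ z, y]], where the first
    factor stays in the lower central term of [g] and the second drops one step in the upper central
    series. *)
Lemma residually_nilpotent_upper_central (H : groupType)
    (Z : normal_subgroup H) j :
  residually_nilpotent H ->
  nset Z = upper_central (derived [set: H]) j ->
  residually_nilpotent (quotient Z).
Proof.
set N := derived _ => rH eZ; apply: residually_nilpotent_quotient.
have sN : is_subgroup N := commutator_subgroup _ _.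
have nN : is_normal_in N [set: H] :=
  commutator_normal (setT_normal H) (setT_normal H).
rewrite {}eZ; elim: j => [|j IH] x hx /=.
  suff : [set 1] x by [].
  rewrite -rH => i i1; have [g hg /= /mulg1_eq] := hx i i1.
  by rewrite invgK => <-.
have Nx : N x.
  have [g hg [Ngx _]] := hx 2 isT.
  by rewrite -(mulVKg g x); exact: (subgroupM sN).
split=> // y Ny; apply: IH => i i1.
have [g hg [Nz Zz]] := hx i i1; set z := g^-1 * x in Nz Zz.
have [sj nj] := upper_central_in sN nN j.
have [si ni] := (lower_central_subgroup H i, lower_central_normal H i).
exists ([~ g, y] ^ z).
  apply: ni.2 => //; rewrite commgEl; apply: (subgroupM si).
    exact: (subgroupV si).
  exact: ni.2.
have -> : ([~ g, y] ^ z)^-1 * [~ x, y] = [~ z, y].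
  have -> : x = g * z by rewrite mulVKg.
  rewrite !commgEl !conjgE !invgM !invgK !mulgA.
  by rewrite !(mulgK, mulgVK, mulVg, mul1g).
exact: Zz.
Qed.

Theorem theorem3p4 (c : nat) (hc : (1 <= c)%N) (G H : groupType)
  (hG : polycyclic_res_nilpotent_by_abelian c G)
  (hH : polycyclic_res_nilpotent_by_abelian c H)
  (phi : UMagmaMorphism.type G H) (hphi : para phi)
  (hcond :
    (residually_nilpotent (quotient (second_derived G)) /\
     residually_nilpotent (quotient (second_derived H))) \/
    (finite_index (upper_central (derived [set: G]) c.-1)
                  (derived (derived [set: G])) /\
     finite_index (upper_central (derived [set: H]) c.-1)
                  (derived (derived [set: H])))) :
  hirsch_length H = hirsch_length G.
Proof.
case: hG hH => pG _ _ [pH rH [Nc _]].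
have sN : is_subgroup (derived [set: H]) := commutator_subgroup _ _.
have nN : is_normal_in (derived [set: H]) [set: H] :=
  commutator_normal (setT_normal H) (setT_normal H).
case: hcond => [[_ rZ]|[_ fin]].
  apply: (@para_hirsch_length _ _ _ hphi (second_derived H) _ _ c) => //.
  - exact: commutator_subl.
  - by move=> z Zz; exists 1%N.
have [sZ nZ] := upper_central_in sN nN c.-1.
pose Z := NormalSubgroup sZ nZ.
have sNN : is_subgroup (derived (derived [set: H])) := commutator_subgroup _ _.
apply: (@para_hirsch_length _ _ _ hphi Z _ _ c) => //.
- have := lower_central_upper_central sN nN (j := c.-1) Nc (leq_pred c).
  (* As [c - c.-1 = 1], the second lower central term of [H'], namely [H''], lies in [Z]. *)
  by rewrite -{1}(prednK hc) subSn // subnn.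
- exact: upper_central_subset.
- exact: residually_nilpotent_upper_central rH _.
- by move=> z Zz; apply: (coset_coloring_power sZ) Zz; apply/finite_indexP.
Qed.
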